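(* Let $d\ge4$ be an integer, constant in $n$. For $n\ge1$ let $B_n=(V_n,E_n)$ with $V_n=\{-n,\dots,-1,0,1,\dots,n\}^d$ and $E_n=\{\{x,y\}\subseteq V_n:\|x-y\|_1=1\}$, and let $P_n$ be the transition matrix on $V_n$ given, for $u=(u_1,\dots,u_d)$ and $v=(v_1,\dots,v_d)$ in $V_n$, by $$P_n(u,v)=\begin{cases}\frac1{2d}&\text{if }\|u-v\|_1=1,\ u_i\ne v_i\text{ and }|u_i|\ne n,\\ \frac1d&\text{if }\|u-v\|_1=1,\ u_i\neq v_i\text{ and }|u_i|=n,\\0&\text{otherwise,}\end{cases}$$ where $i$ is the unique coordinate in which $u$ and $v$ differ. Let $\mathcal D_{\mathrm B}=(\mathfrak d,G,P)$ be the random walk on a growing graph with $G(n)=B_n$ and $P(n)=P_n$, started at the origin $\mathbf 0$. Then $\mathbf 0$ is recurrent by $\mathcal D_{\mathrm B}$ if $$\sum_{n=1}^\infty\frac{\mathfrak d(n)}{n^d}=\infty,$$ and otherwise $\mathbf 0$ is transient by $\mathcal D_{\mathrm B}$.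
   Context: Random walk on a growing graph (RWoGG). A RWoGG is a triple $\mathcal D=(\mathfrak d,G,P)$, where $\mathfrak d:\mathbb Z_{>0}\to\mathbb Z_{\ge0}$ (the duration), $G(n)=(V(n),E(n))$ is a finite simple undirected graph for each $n\ge1$ with $V(n)\subseteq V(n+1)$ and $E(n)\subseteq E(n+1)$, and $P(n)$ is a stochastic matrix on $V(n)$ (transition probabilities of a random walk on $G(n)$). Put $T_0=0$ and $T_n=\sum_{i=1}^n\mathfrak d(i)$; it is assumed that $T_n\to\infty$, so that the walk is defined at all times. The walk $X_0,X_1,X_2,\dots$ started at $v\in V(1)$ is the Markov process with $X_0=v$ in which the transition from $X_t$ to $X_{t+1}$ follows $P(n)$ whenever $T_{n-1}\le t<T_n$. Let $R(t)=\Pr[X_t=v]$. The vertex $v$ is recurrent by $\mathcal D$ if $\sum_{t=1}^\infty R(t)=\infty$, and transient by $\mathcal D$ otherwise. *)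

(* Defs.v *)
From HB Require Import structures.
From mathcomp Require Import all_boot all_order all_algebra.
From mathcomp Require Import all_classical all_reals all_analysis.
From mathcomp Require Import zify ring lra.
Import Order.TTheory GRing.Theory Num.Theory.
Import numFieldNormedType.Exports.

Set Implicit Arguments.
Unset Strict Implicit.
Unset Printing Implicit Defensive.

Local Open Scope classical_set_scope.
Local Open Scope ring_scope.

(* T_n = d(1) + ... + d(n); in particular T_0 = 0, and dur 0 is never used. *)
Definition end_time (dur : nat -> nat) (n : nat) : nat :=
  (\sum_(1 <= i < n.+1) dur i)%N.

(* The phases are numbered from 1: the value of every sequence at 0 is junk.
   The matrix P(n) is the restriction of rw_trans n to V(n) x V(n); its values
   outside V(n) x V(n) carry no meaning and are never used.  The walk may stay
   put, hence the first alternative in rw_trans_adj. *)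
Record rwogg (R : realType) (U : choiceType) := Rwogg {
  rw_dur : nat -> nat ;
  rw_vertex : nat -> set U ;
  rw_edge : nat -> U -> U -> Prop ;
  rw_trans : nat -> U -> U -> R ;
  rw_end_time_cvg : end_time rw_dur n @[n --> \oo] --> \oo ;
  rw_vertex_finite : forall n, (0 < n)%N -> finite_set (rw_vertex n) ;
  rw_edge_vertex : forall n x y, (0 < n)%N ->
    rw_edge n x y -> rw_vertex n x /\ rw_vertex n y ;
  rw_edge_sym : forall n x y, (0 < n)%N -> rw_edge n x y -> rw_edge n y x ;
  rw_edge_irr : forall n x, (0 < n)%N -> ~ rw_edge n x x ;
  rw_vertex_mono : forall n, (0 < n)%N -> rw_vertex n `<=` rw_vertex n.+1 ;
  rw_edge_mono : forall n x y, (0 < n)%N -> rw_edge n x y -> rw_edge n.+1 x y ;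
  rw_trans_ge0 : forall n x y, (0 < n)%N -> rw_vertex n x -> rw_vertex n y ->
    0 <= rw_trans n x y ;
  rw_trans_sum : forall n x, (0 < n)%N -> rw_vertex n x ->
    \sum_(y \in rw_vertex n) rw_trans n x y = 1 ;
  rw_trans_adj : forall n x y, (0 < n)%N -> rw_vertex n x -> rw_vertex n y ->
    rw_trans n x y != 0 -> x = y \/ rw_edge n x y }.

Section Walk.
Context (R : realType) (U : choiceType) (disp : measure_display)
  (Omega : measurableType disp) (Pr : probability Omega R).

Definition trajectory (X : nat -> Omega -> U) (x : nat -> U) (t : nat) :
  set Omega := [set w | forall s, (s <= t)%N -> X s w = x s].

(* walk_step is Pr[X_(t+1) = x_(t+1) | X_0 = x_0, ..., X_t = x_t]
   = P(n+1)(x_t, x_(t+1)) cleared of its denominator. *)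
Record is_walk (D : rwogg R U) (v : U) (X : nat -> Omega -> U) : Prop := IsWalk {
  walk_measurable : forall t x, measurable (X t @^-1` [set x]) ;
  walk_start_vertex : rw_vertex D 1 v ;
  walk_start : Pr [set w | X 0%N w = v] = 1%E ;
  walk_step : forall (n t : nat) (x : nat -> U),
    (end_time (rw_dur D) n <= t < end_time (rw_dur D) n.+1)%N ->
    rw_vertex D n.+1 (x t) -> rw_vertex D n.+1 (x t.+1) ->
    Pr (trajectory X x t.+1) =
      (Pr (trajectory X x t) * (rw_trans D n.+1 (x t) (x t.+1))%:E)%E }.

Definition return_prob (v : U) (X : nat -> Omega -> U) (t : nat) : \bar R :=
  Pr [set w | X t w = v].

Definition recurrent (v : U) (X : nat -> Omega -> U) : Prop :=
  (\sum_(1 <= t <oo) return_prob v X t = +oo)%E.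

Definition transient (v : U) (X : nat -> Omega -> U) : Prop :=
  ~ recurrent v X.

End Walk.

Section Box.
Context (R : realType) (d : nat).
Implicit Types (n : nat) (x y u v : 'rV[int]_d).

Definition l1norm x : int := \sum_(i < d) `|x ord0 i|.

Definition box_vertex n : set 'rV[int]_d :=
  [set x | forall i, `|x ord0 i| <= n%:Z].

Definition box_edge n x y : Prop :=
  [/\ box_vertex n x, box_vertex n y & l1norm (x - y) = 1].

(* At l1-distance 1 the coordinate i with u_i != v_i is unique, so the two tests
   are exclusive. *)
Definition box_trans n u v : R :=
  if (l1norm (u - v) == 1) &&
     [exists i, (u ord0 i != v ord0 i) && (`|u ord0 i| != n%:Z)]
  then (2 * d%:R)^-1
  else if (l1norm (u - v) == 1) &&
     [exists i, (u ord0 i != v ord0 i) && (`|u ord0 i| == n%:Z)]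
  then d%:R^-1
  else 0.

Lemma box_vertex_finite n : finite_set (box_vertex n).
Proof.
pose f (g : {ffun 'I_d -> 'I_(n.*2.+1)}) : 'rV[int]_d :=
  \row_i ((g i)%:Z - n%:Z).
apply: (@sub_finite_set _ _ (f @` setT)); last first.
  by apply: finite_image; exact: finite_finset.
move=> x xn; exists [ffun i => inord (absz (x ord0 i + n%:Z))] => //.
apply/rowP => i; rewrite mxE ffunE.
have := xn i; rewrite ler_norml => /andP[h1 h2].
set z := x ord0 i in h1 h2 *.
have h3 : 0 <= z + n%:Z by rewrite addrC -lerBlDl sub0r.
have h4 : z + n%:Z <= n.*2%:Z by rewrite -addnn PoszD lerD2r.
rewrite inordK ?gez0_abs ?addrK //.
by rewrite ltnS -lez_nat gez0_abs.
Qed.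

Lemma l1norm0 : l1norm 0 = 0.
Proof. by rewrite /l1norm big1 // => i _; rewrite mxE normr0. Qed.

Lemma l1normN x : l1norm (- x) = l1norm x.
Proof. by apply: eq_bigr => i _; rewrite mxE normrN. Qed.

Definition stepv x (i : 'I_d) (b : bool) : 'rV[int]_d :=
  x + (-1) ^+ b *: delta_mx ord0 i.

Lemma stepvE x i b j :
  stepv x i b ord0 j = x ord0 j + (if j == i then (-1) ^+ b else 0).
Proof.
rewrite /stepv !mxE eqxx /=; case: eqP => _; first by rewrite mulr1.
by rewrite mulr0.
Qed.

Lemma l1norm_stepv x i b : l1norm (x - stepv x i b) = 1.
Proof.
rewrite /l1norm (bigD1 i) //= big1 ?addr0 => [|j ji].
  rewrite !mxE !eqxx /=; case: b => /=; lia.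
rewrite !mxE (negbTE ji) andbF; lia.
Qed.

Lemma stepv_neq x i b j : (x ord0 j != stepv x i b ord0 j) = (j == i).
Proof.
rewrite stepvE; case: (eqVneq j i) => _; last by rewrite [_ + 0]addr0 eqxx.
by case: b => /=; lia.
Qed.

Lemma l1norm1P x y : l1norm (x - y) = 1 -> exists i b, y = stepv x i b.
Proof.
move=> h.
have [i hi] : exists i, x ord0 i != y ord0 i.
  apply/existsP; apply: contra_eqT h; rewrite negb_exists => /forallP h.
  rewrite (_ : x - y = 0) ?l1norm0 //.
  by apply/rowP => i; move: (h i); rewrite negbK !mxE => /eqP ->; rewrite subrr.
move: h; rewrite /l1norm (bigD1 i) //= => h.
set S := (\sum_(_ < _ | _) _) in h.
have S0 : 0 <= S by apply: sumr_ge0.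
have hxy j : (x - y) ord0 j = x ord0 j - y ord0 j by rewrite !mxE.
rewrite hxy in h.
have {S0}hS : S = 0 by move: (S) (x ord0 i) (y ord0 i) h hi S0 => z a b; lia.
rewrite hS addr0 in h.
have hj j : j != i -> y ord0 j = x ord0 j.
  move=> ji; move/eqP: hS; rewrite /S psumr_eq0 // => /allP /(_ j).
  rewrite mem_index_enum ji hxy /= => /(_ isT).
  by rewrite normr_eq0 subr_eq0 => /eqP.
exists i, (y ord0 i < x ord0 i); apply/rowP => j; rewrite stepvE.
case: (eqVneq j i) => [->|/hj ->]; last by rewrite addr0.
by move: (x ord0 i) (y ord0 i) h => a b h; case: ltP => /=; lia.
Qed.

Definition step_prob n x (i : 'I_d) : R :=
  if `|x ord0 i| == n%:Z then d%:R^-1 else (2 * d%:R)^-1.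

Lemma box_trans_stepv n x i b : box_trans n x (stepv x i b) = step_prob n x i.
Proof.
rewrite /box_trans l1norm_stepv eqxx /= /step_prob.
have E (p : pred int) : [exists j, (x ord0 j != stepv x i b ord0 j) && p (x ord0 j)]
    = p (x ord0 i).
  apply/existsP/idP => [[j]|h]; first by rewrite stepv_neq => /andP[/eqP ->].
  by exists i; rewrite stepv_neq eqxx.
rewrite (E (fun z => `|z| != n%:Z)) (E (fun z => `|z| == n%:Z)).
by case: eqP.
Qed.

Lemma stepv_inj x i b j c : stepv x i b = stepv x j c -> (i, b) = (j, c).
Proof.
move=> /rowP h; have := h i; rewrite !stepvE eqxx => /addrI.
case: (eqVneq i j) => [->|ij]; last by case: b {h}.
by case: b {h}; case: c.
Qed.

Lemma box_trans_sumE n x y :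
  box_trans n x y = \sum_i \sum_b (if y == stepv x i b then step_prob n x i else 0).
Proof.
rewrite pair_big /=.
have [h|h] := eqVneq (l1norm (x - y)) 1.
  have [i [b ->]] := l1norm1P h.
  rewrite box_trans_stepv (bigD1 (i, b)) //= eqxx big1 ?addr0 // => -[j c] /= n1.
  by case: eqP => // /stepv_inj [ij bc]; rewrite ij bc eqxx in n1.
rewrite /box_trans (negbTE h) /= big1 // => -[i b] _ /=.
by case: eqP => // yE; rewrite yE l1norm_stepv eqxx in h.
Qed.

Lemma box_vertex_stepv n x i b : box_vertex n x ->
  (stepv x i b \in box_vertex n) = (`|x ord0 i + (-1) ^+ b| <= n%:Z).
Proof.
move=> xn; apply/idP/idP => [|h].
  by rewrite inE => /(_ i); rewrite stepvE eqxx.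
rewrite inE => j; rewrite stepvE; case: eqP => [->//|_]; rewrite addr0; exact: xn.
Qed.

Lemma box_trans_sum n x : (0 < d)%N -> (0 < n)%N -> box_vertex n x ->
  \sum_(y \in box_vertex n) box_trans n x y = 1.
Proof.
move=> d0 n0 xn; have Vfin := box_vertex_finite n.
rewrite fsbig_finite //=.
set r := finmap.enum_fset _.
have r_mem y : (y \in r) = (y \in box_vertex n) by rewrite /r in_fset_set.
have r_uniq : uniq r by exact: finmap.fset_uniq.
under eq_bigr do rewrite box_trans_sumE.
rewrite exchange_big /=.
have dn0 : d%:R != 0 :> R by rewrite pnatr_eq0 -lt0n.
suff E i : \sum_(y <- r)
    \sum_b (if y == stepv x i b then step_prob n x i else 0) = d%:R^-1.
  under eq_bigr do rewrite E.
  by rewrite sumr_const card_ord -[LHS]mulr_natl divff.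
rewrite exchange_big /=.
have E b : \sum_(y <- r) (if y == stepv x i b then step_prob n x i else 0) =
    if `|x ord0 i + (-1) ^+ b| <= n%:Z then step_prob n x i else 0.
  rewrite -box_vertex_stepv // -r_mem -big_mkcond /=; case: ifPn => h.
    by rewrite -big_filter filter_pred1_uniq // big_seq1.
  rewrite big1_seq // => y /andP[/eqP -> h2]; by rewrite h2 in h.
under eq_bigr do rewrite E.
rewrite big_bool /= /step_prob expr0 expr1.
have := xn i; move: (x ord0 i) => z; case: eqP => hn hx.
  have [h0|h0] := leP 0 z.
    by rewrite ifT ?ifF ?addr0 ?add0r //; lia.
  by rewrite ifF ?ifT ?add0r ?addr0 //; lia.
rewrite !ifT; [by field | lia..].
Qed.

Lemma box_trans_ge0 n x y : 0 <= box_trans n x y.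
Proof.
rewrite /box_trans; case: ifP => _; first by rewrite invr_ge0 mulr_ge0.
by case: ifP => _ //; rewrite invr_ge0.
Qed.

Lemma box_trans_adj n x y : box_vertex n x -> box_vertex n y ->
  box_trans n x y != 0 -> x = y \/ box_edge n x y.
Proof.
move=> xn yn h; right; split=> //.
by apply: contra_neq_eq h => /negbTE h; rewrite /box_trans h.
Qed.

Lemma box_vertex_mono n : box_vertex n `<=` box_vertex n.+1.
Proof. by move=> x xn i; apply: le_trans (xn i) _; rewrite lez_nat. Qed.

Lemma box_edge_mono n x y : box_edge n x y -> box_edge n.+1 x y.
Proof. by case=> xn yn h; split=> //; exact: box_vertex_mono. Qed.

Lemma box_edge_sym n x y : box_edge n x y -> box_edge n y x.
Proof. by case=> xn yn h; split=> //; rewrite -opprB l1normN. Qed.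

Lemma box_edge_irr n x : ~ box_edge n x x.
Proof. by case=> _ _; rewrite subrr l1norm0. Qed.

Definition box_rwogg (d_ge4 : (4 <= d)%N) (dur : nat -> nat)
    (dur_cvg : end_time dur n @[n --> \oo] --> \oo) : rwogg R 'rV[int]_d :=
  {| rw_dur := dur ;
     rw_vertex := box_vertex ;
     rw_edge := box_edge ;
     rw_trans := box_trans ;
     rw_end_time_cvg := dur_cvg ;
     rw_vertex_finite := fun n _ => @box_vertex_finite n ;
     rw_edge_vertex := fun n x y _ (e : box_edge n x y) =>
       let: And3 xn yn _ := e in conj xn yn ;
     rw_edge_sym := fun n x y _ => @box_edge_sym n x y ;
     rw_edge_irr := fun n x _ => @box_edge_irr n x ;
     rw_vertex_mono := fun n _ => @box_vertex_mono n ;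
     rw_edge_mono := fun n x y _ => @box_edge_mono n x y ;
     rw_trans_ge0 := fun n x y _ _ _ => @box_trans_ge0 n x y ;
     rw_trans_sum := fun n x => @box_trans_sum n x (leq_ltn_trans (leq0n 3) d_ge4) ;
     rw_trans_adj := fun n x y _ => @box_trans_adj n x y |}.

End Box.

(* Main.v *)
Require Import Defs.
From HB Require Import structures.
From mathcomp Require Import all_boot all_order all_algebra.
From mathcomp Require Import all_classical all_reals all_analysis.
From mathcomp Require Import zify ring lra.
Import Order.TTheory GRing.Theory Num.Theory.
Import numFieldNormedType.Exports.
Local Open Scope classical_set_scope.
Local Open Scope ring_scope.

Set Implicit Arguments.
Unset Strict Implicit.
Unset Printing Implicit Defensive.

(** Whether the walk is at the origin only depends on absolute values, and
    reading each coordinate through |x_i| turns the walk in the box of radius m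
    into d reflected walks on {0, ..., m}, one of which moves at each step
    ([walkop m]). By the Markov property the return probability at time t is
    obtained by applying, backward from the indicator of the origin, the
    operators of the boxes met along the way ([ret], [return_probE]).

    Monotonicity.  The functions that decrease whenever a coordinate is increased
    by 2 are stable under [walkop m].  At its boundary a larger box steps from m
    to m + 1 where a smaller one steps from m to m - 1, two units lower, so on
    such functions enlarging a box can only decrease the result: return
    probabilities are antitone in the sequence of radii ([ret_anti]).  Hence a
    growing sequence can be compared with constant ones.

    Lower bound.  If t is even and at most T_m, all boxes met before time t have
    radius at most m, so the return probability is at least that of the fixed box
    m.  The latter is the return probability of the simple walk on the torus
    (Z/2m)^d, a symmetric operator, and by Cauchy-Schwarz it is at least
    (2m)^(-d) at even times ([return_at_ge]).

    Upper bound.  If the last m^3 steps before time t all take place in boxes of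
    radius at least m, compare them with steps in the fixed box m.  By
    monotonicity it suffices to start them from the corners {0, 1}^d, whatever
    happened earlier.  In dimension 1 an explicit solution of a discrete Poisson
    equation bounds the expected number of returns in N steps by m/2 + N/(2m);
    since return probabilities decrease along times of a given parity, the k-th
    one is at most 2/m + 2 (1 - 1/(4m^2))^k.  Bounds of the shape alpha + c rho^k
    survive the random choice of the moving coordinate: the product over the
    coordinates stays bounded by a product of the same shape, with rho replaced
    by 1 - (1 - rho)/d ([prod_avg_le]).  After m^3 steps this gives C/m^d
    ([return_at_le]).

    Conclusion.  The lower bound gives a divergent series of returns as soon as
    the sum of (d(m) - 1) / (2 (2m)^d) diverges.  The upper bound C/m^d holds from
    time T_(m-1) + m^3 on; summing it up to time T_m + (m+1)^3 costs at most
    C (d(m) + 7 m^2) / m^d, and the terms 7 m^2 / m^d are summable because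
    d >= 4. *)

(** * Reflected steps and coordinatewise monotonicity *)

(** The two neighbours of |z| when z moves by one inside {-m, ..., m}: at m both
    are m - 1, at 0 both are 1. *)
Definition up (m a : nat) : nat := if (a < m)%N then a.+1 else a.-1.
Definition dn (a : nat) : nat := if a is a'.+1 then a' else 1%N.

Lemma up_le m a : (0 < m)%N -> (a <= m)%N -> (up m a <= m)%N.
Proof. by rewrite /up; case: (ltnP a m); lia. Qed.

Lemma dn_le m a : (0 < m)%N -> (a <= m)%N -> (dn a <= m)%N.
Proof. by case: a => //= a; lia. Qed.

Section OneDim.
Context {R : realFieldType}.
Implicit Types (g h : nat -> R) (m n a k : nat).

Definition reflop m g a : R := (g (up m a) + g (dn a)) / 2.

Definition decr m g := forall a, (a.+2 <= m)%N -> g a.+2 <= g a.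

Lemma reflop_le m g h a : (0 < m)%N -> (a <= m)%N ->
  (forall b, (b <= m)%N -> g b <= h b) -> reflop m g a <= reflop m h a.
Proof.
move=> m0 am gh; rewrite /reflop ler_pM2r ?invr_gt0 ?ltr0n // lerD ?gh //.
  exact: up_le.
exact: dn_le.
Qed.

(** Pair the upper neighbour of a + 2, which is a + 3 or a + 1, with a + 1, and
    the lower neighbour a + 1 with the lower neighbour of a: paired points are
    equal or two apart. *)
Lemma reflop_decr m g : decr m g -> decr m (reflop m g).
Proof.
move=> gd a am; rewrite /reflop ler_pM2r ?invr_gt0 ?ltr0n // /up.
have -> : (a < m)%N by lia.
apply: lerD.
  by case: ltnP => // ?; exact: gd.
by case: a am => [|a] am //=; apply: gd; lia.
Qed.

(** The two operators differ only at a = m < n, where the smaller box steps to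
    m - 1 and the larger one to m + 1. *)
Lemma reflop_anti m n g a : (0 < m)%N -> (m <= n)%N -> (a <= m)%N -> decr n g ->
  reflop n g a <= reflop m g a.
Proof.
move=> m0 mn am gd; rewrite /reflop ler_pM2r ?invr_gt0 ?ltr0n // lerD2r /up.
case: (ltnP a m) => h1; first by rewrite ifT //; lia.
case: (ltnP a n) => h2 //.
case: a am h1 h2 => [|a] am h1 h2; [lia | exact: gd].
Qed.

Lemma reflop_cst m c a : reflop m (fun=> c) a = c.
Proof. by rewrite /reflop; field. Qed.

End OneDim.

Section Walk.
Context {R : realFieldType} {d : nat}.
Implicit Types (x : 'I_d -> nat) (f g : ('I_d -> nat) -> R) (m n a : nat).

Definition upd x (i : 'I_d) a : 'I_d -> nat := fun j => if j == i then a else x j.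

Lemma upd_same x i a : upd x i a i = a. Proof. by rewrite /upd eqxx. Qed.

Lemma upd_id x i : upd x i (x i) = x.
Proof. by apply/funext => j; rewrite /upd; case: eqP => [->|]. Qed.

Lemma upd_upd x i a b : upd (upd x i a) i b = upd x i b.
Proof. by apply/funext => j; rewrite /upd; case: eqP. Qed.

Lemma updC x i j a b : i != j -> upd (upd x i a) j b = upd (upd x j b) i a.
Proof.
move=> ij; apply/funext => k; rewrite /upd; case: (eqVneq k j) => // ->.
by rewrite eq_sym (negbTE ij).
Qed.

Definition inbox m x := forall i, (x i <= m)%N.

Lemma inbox_upd m x i a : inbox m x -> (a <= m)%N -> inbox m (upd x i a).
Proof. by move=> xm am j; rewrite /upd; case: eqP. Qed.

Lemma inbox_le m n x : (m <= n)%N -> inbox m x -> inbox n x.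
Proof. by move=> mn xm i; exact: leq_trans (xm i) mn. Qed.

Definition walkop m f x : R :=
  d%:R^-1 * \sum_(i < d) reflop m (fun a => f (upd x i a)) (x i).

Definition delta x : R := [forall i, x i == 0%N]%:R.

(** [ret l x] is the probability that the walk started at x is at the origin
    after [size l] steps, when the radii of its successive boxes are listed
    in l. *)
Definition ret (l : seq nat) : ('I_d -> nat) -> R := foldr walkop delta l.

Lemma walkop_le m f g x : (0 < m)%N -> inbox m x ->
  (forall y, inbox m y -> f y <= g y) -> walkop m f x <= walkop m g x.
Proof.
move=> m0 xm fg; apply: ler_wpM2l; first by rewrite invr_ge0.
apply: ler_sum => i _; apply: reflop_le => // b bm; apply: fg.
exact: inbox_upd.
Qed.

Lemma walkop_cst m c x : (0 < d)%N -> walkop m (fun=> c) x = c.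
Proof.
move=> d0; rewrite /walkop; under eq_bigr do rewrite reflop_cst.
rewrite sumr_const card_ord -[c *+ d]mulr_natl mulrA mulVf ?mul1r //.
by rewrite pnatr_eq0 -lt0n.
Qed.

Definition cdecr m f := forall x i, inbox m x -> decr m (fun a => f (upd x i a)).

Lemma cdecr_le m n f : (m <= n)%N -> cdecr n f -> cdecr m f.
Proof.
move=> mn fd x i xm a am; apply: fd; first exact: inbox_le xm.
exact: leq_trans mn.
Qed.

Lemma walkop_cdecr m f : (0 < m)%N -> cdecr m f -> cdecr m (walkop m f).
Proof.
move=> m0 fd x i xm a am; apply: ler_wpM2l; first by rewrite invr_ge0.
apply: ler_sum => j _.
have [->|ij] := eqVneq j i.
  rewrite !upd_same.
  under [X in reflop m X]funext do rewrite upd_upd.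
  under [X in _ <= reflop m X _]funext do rewrite upd_upd.
  by apply: (@reflop_decr _ m _ (fd x i xm)).
have E b : upd x i b j = x j by rewrite /upd (negbTE ij).
rewrite !E; apply: reflop_le => // b bm.
rewrite !(@updC x i j) 1?eq_sym //; apply: fd => //.
exact: inbox_upd.
Qed.

Lemma walkop_anti m n f x : (0 < m)%N -> (m <= n)%N -> inbox m x -> cdecr n f ->
  walkop n f x <= walkop m f x.
Proof.
move=> m0 mn xm fd; apply: ler_wpM2l; first by rewrite invr_ge0.
apply: ler_sum => j _; apply: reflop_anti => //; apply: fd.
exact: inbox_le xm.
Qed.

Lemma delta_ge0 x : 0 <= delta x. Proof. exact: ler0n. Qed.
Lemma delta_le1 x : delta x <= 1. Proof. by rewrite /delta lern1 leq_b1. Qed.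

Lemma delta_cdecr m : cdecr m delta.
Proof.
move=> x i xm a am; rewrite /delta ler_nat.
case: (boolP [forall j, _]) => // /forallP /(_ i).
by rewrite upd_same.
Qed.

Lemma ret_cdecr m l : path leq m l -> (0 < m)%N -> cdecr m (ret l).
Proof.
elim: l m => [|n l IH] m /=; first by move=> _ _; exact: delta_cdecr.
move=> /andP[mn nl] m0; apply: (cdecr_le mn).
by have n0 := leq_trans m0 mn; apply: walkop_cdecr => //; exact: IH.
Qed.

(** Enlarge the boxes one at a time: the first step by [walkop_anti], whose
    hypothesis is [ret_cdecr], the others by induction and positivity. *)
Lemma ret_anti m l l' x : (0 < m)%N -> path leq m l -> path leq m l' ->
  all2 leq l l' -> inbox m x -> ret l' x <= ret l x.
Proof.
elim: l l' m x => [|a l IH] [|b l'] m x //= m0 /andP[ma al] /andP[mb bl'].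
move=> /andP[ab ll'] xm.
have a0 := leq_trans m0 ma; have b0 := leq_trans m0 mb.
have xa := inbox_le ma xm.
apply: le_trans (walkop_anti a0 ab xa (ret_cdecr bl' b0)) _.
apply: walkop_le => // y ya; apply: (IH _ a) => //.
by apply: path_le bl' => //; exact: leq_trans.
Qed.

Lemma ret_nonneg l x m : (0 < m)%N -> path leq m l -> inbox m x -> 0 <= ret l x.
Proof.
elim: l m x => [|n l IH] m x m0 /=; first by move=> *; exact: delta_ge0.
move=> /andP[mn nl] xm; have n0 := leq_trans m0 mn.
have xn := inbox_le mn xm.
rewrite -[0](_ : walkop n (fun=> 0) x = 0); last first.
  by rewrite /walkop big1 ?mulr0 // => i _; rewrite reflop_cst.
by apply: walkop_le => // y; exact: IH.
Qed.

(** The steps in l1 average the values of [ret l2], hence forget everything but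
    their supremum. *)
Lemma ret_cat_le l1 l2 m c x : (0 < d)%N -> (0 < m)%N -> path leq m l1 ->
  (forall y, inbox (last m l1) y -> ret l2 y <= c) ->
  inbox m x -> ret (l1 ++ l2) x <= c.
Proof.
move=> d0; elim: l1 m x => [|n l IH] m x m0 /=.
  by move=> _ H xm; exact: H.
move=> /andP[mn nl] H xm; have n0 := leq_trans m0 mn.
rewrite -[c](@walkop_cst n _ x) //.
apply: walkop_le => //; first exact: inbox_le xm.
by move=> y yn; apply: IH nl _ yn.
Qed.

(** Subtracting 2 from the coordinates as long as possible leads to the point of
    {0, 1}^d with the same parities. *)
Lemma cdecr_corner m f x : (0 < m)%N -> cdecr m f -> inbox m x ->
  f x <= f (fun i => odd (x i) : nat).
Proof.
move=> m0 fd; have [k] := ubnP (\sum_i x i)%N; elim: k x => // k IH x.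
rewrite ltnS => xk xm.
have [/existsP[i xi]|] := boolP [exists i, (1 < x i)%N]; last first.
  rewrite negb_exists => /forallP H.
  rewrite [X in f X <= _](_ : x = fun i => odd (x i) : nat) //.
  by apply/funext => i; move: (H i); case: (x i) => [|[]].
have xm' : inbox m (upd x i (x i - 2)).
  by apply: inbox_upd => //; have := xm i; lia.
have E : (fun j => odd (x j) : nat) = (fun j => odd (upd x i (x i - 2) j) : nat).
  apply/funext => j; rewrite /upd; case: eqP => [->|//]; congr (nat_of_bool _).
  by rewrite oddB // addbF.
rewrite E; apply: le_trans (IH _ _ xm'); last first.
  apply: leq_trans xk; rewrite [X in (_ < X)%N](bigD1 i) //= (bigD1 i) //= upd_same.
  rewrite (eq_bigr x) => [|j /negbTE ji]; last by rewrite /upd ji.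
  by rewrite ltn_add2r; lia.
have /= := fd x i xm (x i - 2)%N.
have -> : ((x i - 2).+2 = x i)%N by lia.
by rewrite upd_id; apply; exact: xm.
Qed.

End Walk.

(** * Decay of the return probability in a fixed box *)

Section Kernel.
Context {R : realFieldType}.
Implicit Types (g h : nat -> R) (m n a k N : nat).

(** The one-dimensional return probability: the reflected walk on {0, ..., m}
    started at a is at 0 after k steps. *)
Definition ret1 m k : nat -> R := iter k (reflop m) (fun a => (a == 0%N)%:R).

Arguments ret1 : simpl never.

Lemma ret1_ge0 m k a : (0 < m)%N -> (a <= m)%N -> 0 <= ret1 m k a.
Proof.
move=> m0; elim: k a => [|k IH] a am; first exact: ler0n.
by rewrite -(@reflop_cst R m 0 a); apply: reflop_le.
Qed.

Lemma ret1_le1 m k a : (0 < m)%N -> (a <= m)%N -> ret1 m k a <= 1.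
Proof.
move=> m0; elim: k a => [|k IH] a am; first by rewrite /ret1 /= lern1 leq_b1.
by rewrite -(@reflop_cst R m 1 a); apply: reflop_le.
Qed.

Lemma ret1_decr m k : decr m (ret1 m k).
Proof. by elim: k => [|k IH]; [move=> a _ /= | exact: reflop_decr]. Qed.

Lemma ret1_from1 m k : (0 < m)%N -> ret1 m k 1 = ret1 m k.+1 0.
Proof. by move=> m0; rewrite /ret1 /= /reflop /up m0 /=; field. Qed.

Lemma ret1_anti m k : (0 < m)%N -> ret1 m k.+2 0 <= ret1 m k 0.
Proof.
move=> m0; rewrite -ret1_from1 // [ret1 m k.+1]/ret1 iterS -/(ret1 m k) /reflop /up /=.
have kd := @ret1_decr m k.
case: ltnP => m1 /=; first by have := kd 0%N m1; lra.
lra.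
Qed.

(** On the box the function h(a) = (m - a)^2 / (2m) satisfies
    reflop m h = h + 1/(2m) - 1_0, so h + N/(2m) dominates the expected number of
    visits to 0 before time N. *)
Lemma ret1_sum_le m N a : (0 < m)%N -> (a <= m)%N ->
  \sum_(k < N) ret1 m k a <= (m%:R - a%:R) ^+ 2 / (2 * m%:R) + N%:R / (2 * m%:R).
Proof.
move=> m0; have mR : 0 < m%:R :> R by rewrite ltr0n.
elim: N a => [|N IH] a am.
  rewrite big_ord0 mul0r addr0; apply: divr_ge0; first exact: sqr_ge0.
  by rewrite mulr_ge0.
rewrite big_ord_recl /=.
have -> : \sum_(i < N) ret1 m (bump 0 i) a = reflop m (fun b => \sum_(i < N) ret1 m i b) a.
  by rewrite /reflop -big_split mulr_suml; apply: eq_bigr.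
apply: (le_trans (lerD (lexx _) (reflop_le m0 am IH))).
rewrite /ret1 /= /reflop /up -natr1.
have [e|am'] := eqVneq a m.
  rewrite e ltnn; case: m m0 mR {IH am e} => // k _ kR /=.
  rewrite add0r -!natr1; rewrite -natr1 in kR.
  rewrite le_eqVlt; apply/orP; left; apply/eqP; field; lra.
have am2 : (a < m)%N by lia.
rewrite am2; case: a am am' am2 => [|a] am am' am2 /=.
  rewrite le_eqVlt; apply/orP; left; apply/eqP; field; lra.
rewrite -!natr1 add0r.
rewrite le_eqVlt; apply/orP; left; apply/eqP; field; lra.
Qed.

(** Pair the times 2j and 2j + 1: in each pair one time has the parity of k, and
    the return probability decreases along that parity. *)
Lemma ret1_le_avg m L k : (0 < m)%N -> (L.*2 <= k)%N ->
  L%:R * ret1 m k 0 <= \sum_(j < L.*2) ret1 m j 0.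
Proof.
move=> m0; elim: L k => [|L IH] k Lk; first by rewrite big_ord0 mul0r.
have anti j i : ret1 m (j + i.*2) 0 <= ret1 m j 0.
  elim: i => [|i IHi]; first by rewrite addn0.
  rewrite doubleS !addnS; exact: le_trans (ret1_anti _ m0) IHi.
rewrite doubleS !big_ord_recr /= -natr1 mulrDl mul1r -addrA; apply: lerD.
  by apply: IH; rewrite doubleS in Lk; lia.
have := anti (if odd k then L.*2.+1 else L.*2) (k./2 - L)%N.
have -> : ((if odd k then L.*2.+1 else L.*2) + (k./2 - L).*2 = k)%N.
  by case: ifP; lia.
move/le_trans; apply.
have l0 j : 0 <= ret1 m j 0 by apply: ret1_ge0.
by have := l0 L.*2; have := l0 L.*2.+1; case: ifP => _; lra.
Qed.

(** Average over the first 2 m^2 times, during which at most 3m/2 returns are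
    expected. *)
Lemma ret1_le m k : (0 < m)%N -> (2 * m ^ 2 <= k)%N -> ret1 m k 0 <= 2 / m%:R.
Proof.
move=> m0 mk; have mR : 0 < m%:R :> R by rewrite ltr0n.
have := @ret1_le_avg m (m ^ 2) k m0.
rewrite -mul2n => /(_ mk) H.
have := le_trans H (@ret1_sum_le m (2 * m ^ 2) 0 m0 (leq0n m)).
rewrite natrM natrX subr0 => H2.
have m2 : 0 < m%:R ^+ 2 :> R by rewrite exprn_gt0.
rewrite -(ler_pM2l m2); apply: le_trans H2 _.
rewrite -subr_ge0.
have -> : m%:R ^+ 2 * (2 / m%:R) - (m%:R ^+ 2 / (2 * m%:R) + 2 * m%:R ^+ 2 / (2 * m%:R))
   = m%:R / 2 :> R by field; lra.
by rewrite divr_ge0 ?ltW.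
Qed.

Lemma bernoulli (x : R) k : 0 <= x <= 1 -> 1 - k%:R * x <= (1 - x) ^+ k.
Proof.
move=> /andP[x0 x1]; elim: k => [|k IH]; first by rewrite mul0r subr0.
have x1' : 0 <= 1 - x by rewrite subr_ge0.
rewrite exprSr; apply: le_trans (ler_wpM2r x1' IH).
rewrite -natr1 -subr_ge0.
have -> : (1 - k%:R * x) * (1 - x) - (1 - (k%:R + 1) * x) = k%:R * (x * x) by ring.
by rewrite mulr_ge0 // mulr_ge0.
Qed.

Lemma pow_inv_le (x : R) k : 0 <= x <= 1 -> (1 - x) ^+ k * (1 + k%:R * x) <= 1.
Proof.
move=> /andP[x0 x1]; elim: k => [|k IH]; first by rewrite mul0r addr0 mulr1.
have x1' : 0 <= 1 - x by rewrite subr_ge0.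
apply: le_trans IH; rewrite exprSr -mulrA; apply: ler_wpM2l; first exact: exprn_ge0.
rewrite -natr1 -subr_ge0.
have -> : 1 + k%:R * x - (1 - x) * (1 + (k%:R + 1) * x) = (k%:R + 1) * (x * x) by ring.
by rewrite mulr_ge0 ?mulr_ge0 // addr_ge0.
Qed.

(** By Bernoulli's inequality [rate m ^+ k >= 1/2] up to k = 2 m^2, the range
    that [ret1_le] leaves open. *)
Definition rate m : R := 1 - (4 * m%:R ^+ 2)^-1.

Lemma rate_bound m : (0 < m)%N -> 0 <= ((4 * m%:R ^+ 2)^-1 : R) <= 1.
Proof.
move=> m0; rewrite invr_ge0 mulr_ge0 ?exprn_ge0 //=.
rewrite invf_le1; first by rewrite -natrX -natrM ler1n muln_gt0 expn_gt0 m0.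
by rewrite mulr_gt0 // exprn_gt0 // ltr0n.
Qed.

Lemma rate_ge0 m : (0 < m)%N -> 0 <= rate m.
Proof. by move=> m0; have /andP[_] := rate_bound m0; rewrite subr_ge0. Qed.

Lemma rate_le1 m : (0 < m)%N -> rate m <= 1.
Proof. by move=> m0; have /andP[? _] := rate_bound m0; rewrite /rate; lra. Qed.

Lemma ret1_rate m k : (0 < m)%N -> ret1 m k 0 <= 2 / m%:R + 2 * rate m ^+ k.
Proof.
move=> m0; have mR : 0 < m%:R :> R by rewrite ltr0n.
have r0 := exprn_ge0 k (rate_ge0 m0).
have [km|km] := leqP (2 * m ^ 2) k.
  by apply: le_trans (ret1_le m0 km) _; rewrite lerDl mulr_ge0.
apply: le_trans (ret1_le1 _ m0 (leq0n m)) _.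
have := bernoulli k (rate_bound m0); rewrite -/(rate m).
have : k%:R * (4 * m%:R ^+ 2)^-1 <= 2^-1 :> R.
  rewrite ler_pdivrMr ?mulr_gt0 ?exprn_gt0 //.
  have -> : 2^-1 * (4 * m%:R ^+ 2) = (2 * m ^ 2)%N%:R :> R.
    by rewrite natrM natrX; field.
  by rewrite ler_nat ltnW.
have : 0 <= 2 / m%:R :> R by rewrite divr_ge0.
lra.
Qed.

Lemma ret1_corner_rate m k (b : bool) : (0 < m)%N ->
  ret1 m k b <= 2 / m%:R + 2 * rate m ^+ k.
Proof.
move=> m0; case: b => /=; last exact: ret1_rate.
rewrite ret1_from1 //; apply: le_trans (ret1_rate _ m0) _.
rewrite lerD2l ler_pM2l // exprSr ler_piMr ?rate_le1 //.
exact: exprn_ge0 (rate_ge0 m0).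
Qed.

End Kernel.

Section Tensor.
Context {R : realFieldType} {d : nat}.
Context (d0 : (0 < d)%N).
Implicit Types (k : 'I_d -> nat).

(** Weierstrass product inequality. *)
Lemma prod_onem_ge (I : Type) (r : seq I) (e : I -> R) : (forall i, 0 <= e i <= 1) ->
  1 - \sum_(i <- r) e i <= \prod_(i <- r) (1 - e i).
Proof.
move=> e01; suff [] : 1 - \sum_(i <- r) e i <= \prod_(i <- r) (1 - e i) /\
   0 <= \prod_(i <- r) (1 - e i) <= 1 by [].
elim: r => [|i r [IH /andP[p0 p1]]]; first by rewrite !big_nil subr0 lexx ler01.
rewrite !big_cons; move: (\sum_(_ <- _) _) (\prod_(_ <- _) _) IH p0 p1 => s p IH p0 p1.
have /andP[? ?] := e01 i; split; last by apply/andP; split; nra.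
by nra.
Qed.

(** One step of the d-dimensional walk multiplies by rho the part y_i of a
    randomly chosen coordinate.  After division by the product of the al + y_j,
    this is the Weierstrass inequality for
    e_j = (1 - rho) / d * y_j / (al + y_j). *)
Lemma prod_avg_le (al rho : R) (y : 'I_d -> R) : 0 < al -> 0 <= rho <= 1 ->
  (forall i, 0 <= y i) ->
  d%:R^-1 * \sum_(i < d) \prod_(j < d) (al + (if j == i then rho else 1) * y j)
   <= \prod_(j < d) (al + (1 - (1 - rho) / d%:R) * y j).
Proof.
move=> al0 /andP[r0 r1] y0.
have dR : 0 < d%:R :> R by rewrite ltr0n.
have z0 j : 0 < al + y j by apply: ltr_wpDr.
pose e j := (1 - rho) / d%:R * (y j / (al + y j)).
have e01 j : 0 <= e j <= 1.
  have A : 0 <= (1 - rho) / d%:R <= 1.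
    rewrite divr_ge0 ?subr_ge0 // ler_pdivrMr // mul1r.
    by apply: (@le_trans _ _ 1); rewrite ?ler1n //; lra.
  have B : 0 <= y j / (al + y j) <= 1.
    by rewrite (divr_ge0 (y0 j) (ltW (z0 j))) /= ler_pdivrMr // mul1r lerDr ltW.
  case/andP: A => A1 A2; case/andP: B => B1 B2.
  by rewrite /e mulr_ge0 //= mulr_ile1.
have E i : \prod_(j < d) (al + (if j == i then rho else 1) * y j) =
    \prod_(j < d) (al + y j) * (1 - d%:R * e i).
  rewrite (bigD1 i) //= [in RHS](bigD1 i) //= eqxx.
  rewrite (eq_bigr (fun j => al + y j)); last by move=> j /negbTE ->; rewrite mul1r.
  rewrite mulrAC; congr (_ * _); rewrite /e; field; have := z0 i; lra.
have F j : al + (1 - (1 - rho) / d%:R) * y j = (al + y j) * (1 - e j).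
  by rewrite /e; field; have := z0 j; lra.
under eq_bigr do rewrite E.
under [X in _ <= X]eq_bigr do rewrite F.
rewrite big_split /= -mulr_sumr mulrCA; apply: ler_wpM2l.
  by apply: prodr_ge0 => j _; exact: ltW.
apply: le_trans (prod_onem_ge _ e01).
rewrite sumrB sumr_const card_ord -mulr_sumr mulrBr mulrA.
by rewrite mulVf ?gt_eqF // !mul1r.
Qed.

(** What coordinates that have moved k_i times contribute to the return
    probability: given how often each coordinate has moved, they are independent. *)
Definition tens m k (x : 'I_d -> nat) : R := \prod_(i < d) ret1 m (k i) (x i).

Lemma delta_tens m : @delta R d = tens m (fun=> 0%N).
Proof.
apply: funext => x; rewrite /delta /tens /ret1 /=.
have [/forallP H|] := boolP [forall i, x i == 0%N].
  by rewrite big1 // => i _; rewrite H.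
by rewrite negb_forall => /existsP[i /negbTE xi]; rewrite (bigD1 i) //= xi mul0r.
Qed.

Lemma walkop_tens m k x :
  walkop m (tens m k) x = d%:R^-1 * \sum_(i < d) tens m (upd k i (k i).+1) x.
Proof.
rewrite /walkop; congr (_ * _); apply: eq_bigr => i _.
have T k' y : tens m k' y =
    ret1 m (k' i) (y i) * \prod_(j < d | j != i) ret1 m (k' j) (y j).
  by rewrite /tens (bigD1 i).
rewrite /reflop !T !upd_same.
have E a : \prod_(j < d | j != i) ret1 m (k j) (upd x i a j) =
           \prod_(j < d | j != i) ret1 m (k j) (x j).
  by apply: eq_bigr => j /negbTE ji; rewrite /upd ji.
have -> : \prod_(j < d | j != i) ret1 m (upd k i (k i).+1 j) (x j) =
           \prod_(j < d | j != i) ret1 m (k j) (x j) :> R.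
  by apply: eq_bigr => j /negbTE ji; rewrite /upd ji.
by rewrite !E -mulrDl mulrAC.
Qed.

Lemma walkop_lin m (c : R) (F : 'I_d -> ('I_d -> nat) -> R) x :
  walkop m (fun y => c * \sum_(i < d) F i y) x = c * \sum_(i < d) walkop m (F i) x.
Proof.
rewrite /walkop -mulr_sumr mulrCA; congr (_ * _).
rewrite [in RHS]exchange_big mulr_sumr /=.
apply: eq_bigr => i _; rewrite /reflop -mulr_suml big_split /=; ring.
Qed.

Lemma iter_walkop_lin m K (c : R) (F : 'I_d -> ('I_d -> nat) -> R) x :
  iter K (walkop m) (fun y => c * \sum_(i < d) F i y) x =
  c * \sum_(i < d) iter K (walkop m) (F i) x.
Proof.
elim: K x => //= K IH x; rewrite -walkop_lin; congr walkop; exact/funext.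
Qed.

(** The averaged effect of a step on one coordinate, which moves with
    probability 1/d. *)
Definition walk_rate m : R := 1 - (1 - rate m) / d%:R.

Lemma walk_rateE m : walk_rate m = 1 - (4 * m%:R ^+ 2)^-1 / d%:R.
Proof. by rewrite /walk_rate /rate; congr (1 - _ / _); ring. Qed.

Lemma walk_rate_bound m : (0 < m)%N -> 0 <= ((4 * m%:R ^+ 2)^-1 / d%:R : R) <= 1.
Proof.
move=> m0; have dR : 0 < d%:R :> R by rewrite ltr0n.
have /andP[A B] := @rate_bound R m m0.
rewrite divr_ge0 //= ler_pdivrMr // mul1r; apply: le_trans B _.
by rewrite ler1n.
Qed.

(** Conditioning on the first coordinate to move replaces k by k + e_i with
    probability 1/d, which is the averaging of [prod_avg_le]. *)
Lemma iter_tens_le m K k (b : 'I_d -> bool) : (0 < m)%N ->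
  iter K (walkop m) (tens m k) (fun i => b i : nat) <=
  \prod_(i < d) (2 / m%:R + walk_rate m ^+ K * (2 * rate m ^+ k i)).
Proof.
move=> m0; have mR : 0 < m%:R :> R by rewrite ltr0n.
elim: K k => [|K IH] k.
  apply: ler_prod => i _; rewrite ret1_ge0 //=; last by case: (b i).
  by rewrite expr0 mul1r; exact: ret1_corner_rate.
rewrite iterSr.
have -> : walkop m (tens m k) =
    (fun y => d%:R^-1 * \sum_(i < d) tens m (upd k i (k i).+1) y).
  by apply/funext => y; exact: walkop_tens.
rewrite iter_walkop_lin.
have r0 := @rate_ge0 R m m0; have r1 := @rate_le1 R m m0.
have D0 : 0 <= walk_rate m.
  by rewrite walk_rateE; have /andP[] := walk_rate_bound m0; lra.
apply: le_trans (_ : d%:R^-1 * \sum_(i < d) \prod_(j < d) (2 / m%:R +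
   (if j == i then rate m else 1) * (walk_rate m ^+ K * (2 * rate m ^+ k j))) <= _).
  apply: ler_wpM2l; first by rewrite invr_ge0.
  apply: ler_sum => i _; apply: le_trans (IH _) _.
  rewrite le_eqVlt; apply/orP; left; apply/eqP; apply: eq_bigr => j _.
  rewrite /upd; case: eqP => [->|_]; last by rewrite mul1r.
  rewrite exprS; ring.
apply: le_trans (prod_avg_le _ _ _) _.
- by rewrite divr_gt0.
- by rewrite r0.
- by move=> i; rewrite mulr_ge0 ?mulr_ge0 ?exprn_ge0.
rewrite -/(walk_rate m) le_eqVlt; apply/orP; left; apply/eqP.
by apply: eq_bigr => j _; rewrite exprS; ring.
Qed.

(** Since (1 - x)^K <= 1 / (1 + K x), the K = m^3 steps with x = 1/(4 d m^2)
    bring the geometric part below 4d/m. *)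
Lemma iter_delta_le m (b : 'I_d -> bool) : (0 < m)%N ->
  iter (m ^ 3) (walkop m) delta (fun i => b i : nat) <=
  (2 + 8 * d%:R) ^+ d / m%:R ^+ d :> R.
Proof.
move=> m0; have mR : 0 < m%:R :> R by rewrite ltr0n.
have dR : 0 < d%:R :> R by rewrite ltr0n.
rewrite (delta_tens m); apply: le_trans (iter_tens_le _ _ _ m0) _.
rewrite prodr_const card_ord -expr_div_n; apply: lerXn2r.
- rewrite nnegrE addr_ge0 ?divr_ge0 // ?mulr_ge0 // exprn_ge0 //.
  by rewrite walk_rateE; have /andP[] := walk_rate_bound m0; lra.
- by rewrite nnegrE divr_ge0 // addr_ge0 // mulr_ge0.
rewrite /= mulr1 [X in _ <= X]mulrDl lerD2l.
have := pow_inv_le (m ^ 3) (walk_rate_bound m0); rewrite -walk_rateE.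
have -> : (m ^ 3)%N%:R * ((4 * m%:R ^+ 2)^-1 / d%:R) = m%:R / (4 * d%:R) :> R.
  by rewrite natrX; field; rewrite !gt_eqF.
have D0 : 0 <= walk_rate m ^+ (m ^ 3).
  by apply: exprn_ge0; rewrite walk_rateE; have /andP[] := walk_rate_bound m0; lra.
rewrite mulrDr mulr1 => H.
have H2 : walk_rate m ^+ (m ^ 3) * (m%:R / (4 * d%:R)) <= 1 by lra.
have -> : 8 * d%:R / m%:R = 2 * (m%:R / (4 * d%:R))^-1 :> R.
  by field; rewrite !gt_eqF.
rewrite mulrC ler_pM2l // -[X in _ <= X]mul1r ler_pdivlMr //.
by rewrite divr_gt0 // mulr_gt0.
Qed.

End Tensor.

(** * Lower bound in a fixed box by folding a torus *)

Section Torus.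
Context {R : realFieldType} {d : nat}.
Context (d0 : (0 < d)%N).
Context (n' : nat).
Local Notation n := n'.+1.
Local Notation Z := 'I_(n'.*2.+2).
Local Notation T := 'rV[Z]_d.
Implicit Types (f g : T -> R) (F : ('I_d -> nat) -> R) (x : T) (z : Z).

(** Distance to 0 on the cycle Z/2n: the reflected walk on {0, ..., n} is the
    image of the simple walk on the cycle. *)
Definition fold z : nat := minn z (n.*2 - z).

Lemma fold_step (h : nat -> R) z :
  h (fold (z + 1)) + h (fold (z - 1)) = h (up n (fold z)) + h (dn (fold z)).
Proof.
have z2 := ltn_ord z.
have E1 : val (z + 1) = if (z == n.*2.-1 :> nat) then 0%N else z.+1.
  rewrite /= modnDmr addn1.
  case: eqP => e; first by rewrite e /= modnn.
  by rewrite modn_small //; lia.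
have E2 : val (z - 1) = if (z == 0%N :> nat) then n.*2.-1 else z.-1.
  rewrite /= (@modn_small 1) // subn1 /= modnDmr.
  case: eqP => e; first by rewrite e add0n modn_small.
  have -> : (z + n'.*2.+1 = z.-1 + n'.*2.+2)%N by lia.
  by rewrite modnDr modn_small //; lia.
rewrite /fold E1 E2 /up /dn; move: (val z) z2 => a a2 {E1 E2}.
have [->|a0] := eqVneq a 0%N.
  by rewrite !min0n /=; congr (h _ + h _); lia.
have [e|a1] := eqVneq a n.*2.-1.
  have -> : minn a (n.*2 - a) = 1%N by lia.
  have -> : minn 0 (n.*2 - 0) = 0%N by lia.
  rewrite addrC; case: ltnP => H /=; congr (h _ + h _); lia.
have -> : h match minn a (n.*2 - a) with 0 => 1%N | S b => b end = h (minn a (n.*2 - a)).-1.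
  by congr h; move: a0 a1 a2; case E : (minn _ _) => [|b] //; lia.
have [an|an] := ltnP a n; first by rewrite ifT; [congr (h _ + h _)|]; lia.
have [->|an'] := eqVneq a n; first by rewrite ifF; [congr (h _ + h _)|]; lia.
by rewrite addrC ifT; [congr (h _ + h _)|]; lia.
Qed.

Definition foldv x : 'I_d -> nat := fun i => fold (x ord0 i).

Local Notation e i := (delta_mx ord0 i : T).

Definition torusop f x : R := d%:R^-1 * \sum_(i < d) (f (x + e i) + f (x - e i)) / 2.

Lemma foldv_upd x i (s : Z) :
  foldv (x + s *: e i) = upd (foldv x) i (fold (x ord0 i + s)).
Proof.
apply/funext => j; rewrite /foldv /upd !mxE eqxx /=.
by case: eqP => [->|_]; rewrite ?mulr1 // mulr0 addr0.
Qed.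

Lemma torusop_fold F x : torusop (F \o foldv) x = walkop n F (foldv x).
Proof.
rewrite /torusop /walkop; congr (_ * _); apply: eq_bigr => i _.
rewrite /reflop -(fold_step (fun a => F (upd (foldv x) i a))) /=.
by rewrite -!foldv_upd scale1r scaleN1r.
Qed.

Lemma iter_torusop_fold k F x :
  iter k torusop (F \o foldv) x = iter k (walkop n) F (foldv x).
Proof.
elim: k x => //= k IH x; rewrite -torusop_fold; congr torusop; exact/funext.
Qed.

Lemma delta_fold : @delta R d \o foldv = fun x => (x == 0)%:R.
Proof.
apply/funext => x; rewrite /delta /=; congr (_%:R); congr nat_of_bool.
apply/forallP/eqP => [H|->]; last by move=> i; rewrite /foldv /fold mxE /= min0n.
apply/rowP => i; apply/val_inj; rewrite mxE /=.
move: (H i); rewrite /foldv /fold; case: (x ord0 i) => a a2 /= /eqP; lia.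
Qed.

(** Translations of the torus are bijections, and the steps +e_i and -e_i are
    inverse to each other. *)
Lemma torusop_sym f g :
  \sum_x torusop f x * g x = \sum_x f x * torusop g x.
Proof.
rewrite /torusop.
under eq_bigr => x _ do rewrite -mulrA mulr_suml.
under [RHS]eq_bigr => x _ do rewrite mulrCA mulr_sumr.
rewrite -!mulr_sumr; congr (_ * _); rewrite exchange_big [RHS]exchange_big /=.
apply: eq_bigr => i _.
under eq_bigr => x _ do rewrite mulrAC mulrDl.
under [RHS]eq_bigr => x _ do rewrite mulrA mulrDr.
rewrite -!mulr_suml !big_split /= [in RHS]addrC; congr ((_ + _) / _).
  rewrite [RHS](reindex_inj (addIr (e i))) /=.
  by apply: eq_bigr => x _; rewrite addrK.
rewrite [RHS](reindex_inj (addIr (- e i))) /=.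
by apply: eq_bigr => x _; rewrite subrK.
Qed.

Lemma iter_torusop_sym k f g :
  \sum_x iter k torusop f x * g x = \sum_x f x * iter k torusop g x.
Proof.
elim: k g => //= k IH g; rewrite torusop_sym IH; apply: eq_bigr => x _.
by rewrite -iterSr.
Qed.

Lemma iter_torusop_cst k c : iter k torusop (fun=> c) = fun=> c.
Proof.
elim: k => //= k ->; apply/funext => x; rewrite /torusop.
under eq_bigr do rewrite -mulr2n -[c *+ 2]mulr_natr mulfK //.
rewrite sumr_const card_ord -[c *+ d]mulr_natl mulrA mulVf ?mul1r //.
by rewrite pnatr_eq0 -lt0n.
Qed.

(** By symmetry the return probability at time 2k is the sum of the squares of
    the law u at time k; u has total mass 1 on (2n)^d points, so Cauchy-Schwarz
    applies, in the form sum (u - c)^2 >= 0 with c = (2n)^(-d). *)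
Lemma torus_return_ge k :
  ((n.*2)%:R ^+ d)^-1 <= iter k.*2 torusop (fun x => (x == 0)%:R) 0.
Proof.
set dl := (fun x => _); set u := iter k torusop dl.
have E0 (v : T -> R) : \sum_x dl x * v x = v 0.
  rewrite (bigD1 0) //= /dl eqxx mul1r big1 ?addr0 // => x /negbTE ->.
  by rewrite mul0r.
have E : iter k.*2 torusop dl 0 = \sum_x u x ^+ 2.
  have -> : k.*2 = (k + k)%N by rewrite addnn.
  rewrite -E0 iterD -/u -iter_torusop_sym.
  by apply: eq_bigr => x _; rewrite expr2.
have S : \sum_x u x = 1.
  under eq_bigr do rewrite -[u _]mulr1.
  by rewrite /u (iter_torusop_sym k dl (fun=> 1)) iter_torusop_cst E0.
rewrite E; set c := _^-1.
have N0 : 0 < (n.*2)%:R ^+ d :> R by rewrite exprn_gt0 // ltr0n.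
have : 0 <= \sum_x (u x - c) ^+ 2 by apply: sumr_ge0 => x _; exact: sqr_ge0.
under eq_bigr do rewrite sqrrB.
rewrite big_split sumrB /= sumr_const sumrMnl -mulr_suml S mul1r.
have -> : c ^+ 2 *+ #|{: T}| = c.
  by rewrite card_mx mul1n card_ord -mulr_natl natrX expr2 mulrA /c mulfV ?mul1r.
by rewrite mulr2n; lra.
Qed.

Lemma iter_delta_ge k :
  ((n.*2)%:R ^+ d)^-1 <= iter k.*2 (@walkop R d n) delta (fun=> 0%N).
Proof.
have -> : (fun=> 0%N) = foldv 0.
  by apply/funext => i; rewrite /foldv /fold mxE /= min0n.
by rewrite -iter_torusop_fold delta_fold; exact: torus_return_ge.
Qed.

End Torus.

(** * From the walk in the box to absolute values *)

Lemma dnE a : (0 < a)%N -> dn a = a.-1.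
Proof. by case: a. Qed.

Section Bridge.
Context (R : realType) (d : nat).
Context (d0 : (0 < d)%N).

Definition absv (x : 'rV[int]_d) : 'I_d -> nat := fun i => (absz (x ord0 i)).

Lemma absv_stepv x i b :
  absv (stepv x i b) = upd (absv x) i (absz (x ord0 i + (-1) ^+ b)).
Proof.
apply/funext => j; rewrite /absv /upd stepvE.
by case: eqP => [->|_] //; rewrite addr0.
Qed.

(** For |x_i| < n both signs are allowed, with weight 1/(2d) each; for |x_i| = n
    one sign is allowed with weight 1/d, and the two neighbours of the folded
    walk coincide. *)
Lemma box_trans_sum_absv n (F : ('I_d -> nat) -> R) x : (0 < n)%N ->
  box_vertex n x ->
  \sum_(y <- finmap.enum_fset (fset_set (@box_vertex d n)))
     box_trans R n x y * F (absv y) = walkop n F (absv x).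
Proof.
move=> n0 xn; have Vfin := box_vertex_finite d n.
set r := finmap.enum_fset _.
have r_mem y : (y \in r) = (y \in box_vertex n) by rewrite /r in_fset_set.
have r_uniq : uniq r by exact: finmap.fset_uniq.
under eq_bigr do rewrite box_trans_sumE mulr_suml.
rewrite exchange_big /walkop mulr_sumr; apply: eq_bigr => i _ /=.
under eq_bigr do rewrite mulr_suml.
rewrite exchange_big /=.
have E b : \sum_(y <- r) (if y == stepv x i b then step_prob R n x i else 0) * F (absv y) =
    if `|x ord0 i + (-1) ^+ b| <= n%:Z then
      step_prob R n x i * F (upd (absv x) i (absz (x ord0 i + (-1) ^+ b))) else 0.
  rewrite -box_vertex_stepv // -r_mem -absv_stepv.
  under eq_bigr do rewrite (fun_if (fun p => p * _)) mul0r.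
  rewrite -big_mkcond /=; case: ifPn => h.
    by rewrite -big_filter filter_pred1_uniq // big_seq1.
  rewrite big1_seq // => y /andP[/eqP -> h2]; by rewrite h2 in h.
under eq_bigr do rewrite E.
have dR : d%:R != 0 :> R by rewrite pnatr_eq0 -lt0n.
rewrite big_bool /= expr0 expr1 /step_prob /reflop.
pose h a := F (upd (absv x) i a).
have hE a : F (upd (absv x) i a) = h a by [].
rewrite !hE (_ : absv x i = absz (x ord0 i)) //.
have := xn i; clear E hE; move: (x ord0 i) h => z h hz.
have [hn|hn] := eqVneq `|z| n%:Z.
  have -> : up n (absz z) = (absz z).-1 by rewrite /up ifF //; lia.
  have [z0|z0] := leP 0 z.
    rewrite ifT; last by lia.
    rewrite ifF; last by lia.
    have -> : (absz (z + -1)) = (absz z).-1 by lia.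
    have -> : dn (absz z) = (absz z).-1 by apply: dnE; lia.
    by rewrite addr0; field.
  rewrite ifF; last by lia.
  rewrite ifT; last by lia.
  have -> : (absz (z + 1)) = (absz z).-1 by lia.
  have -> : dn (absz z) = (absz z).-1 by apply: dnE; lia.
  by rewrite add0r; field.
rewrite !ifT; try lia.
have -> : up n (absz z) = (absz z).+1 by rewrite /up ifT //; lia.
have [z0|z0] := ltP 0 z.
  have -> : (absz (z + 1)) = (absz z).+1 by lia.
  have -> : (absz (z + -1)) = dn (absz z) by rewrite dnE; lia.
  by field.
have [->|z1] := eqVneq z 0; first by rewrite /=; field.
have -> : (absz (z + -1)) = (absz z).+1 by lia.
have -> : (absz (z + 1)) = dn (absz z) by rewrite dnE; lia.
by field.
Qed.

End Bridge.

(** * The law of the walk as an iterated operator *)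

Section ProbTools.
Context {disp : measure_display} {T : measurableType disp} {R : realType}
  (Pr : probability T R).
Implicit Types A B : set T.

Definition prob A : R := fine (Pr A).

Lemma probE A : measurable A -> Pr A = (prob A)%:E.
Proof. by move=> mA; rewrite fineK // fin_num_measure. Qed.

Lemma prob_ge0 A : 0 <= prob A.
Proof. exact: fine_ge0. Qed.

Lemma prob_le A B : measurable A -> measurable B -> A `<=` B -> prob A <= prob B.
Proof.
move=> mA mB AB; rewrite -lee_fin -!probE //.
by apply: le_measure => //; rewrite inE.
Qed.

Lemma probDI A B : measurable A -> measurable B ->
  prob A = prob (A `\` B) + prob (A `&` B).
Proof.
move=> mA mB; apply: EFin_inj; rewrite EFinD -!probE //.
- exact: measureDI.
- exact: measurableI.
- exact: measurableD.
Qed.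

Lemma prob_partition (U : choiceType) (Y : T -> U) (r : seq U) A :
  (forall y, measurable (Y @^-1` [set y])) -> measurable A -> uniq r ->
  prob A = \sum_(y <- r) prob (A `&` Y @^-1` [set y]) +
           prob (A `\` [set w | Y w \in r]).
Proof.
move=> mY; elim: r A => [|z r IH] A mA /=.
  move=> _; rewrite big_nil add0r; congr prob.
  by apply/seteqP; split => w //= -[].
move=> /andP[zr ur]; rewrite big_cons (probDI mA (mY z)) addrC -addrA; congr (_ + _).
rewrite (IH _ (measurableD mA (mY z)) ur); congr (_ + _).
  rewrite !big_seq; apply: eq_bigr => y yr; congr prob.
  apply/seteqP; split => w /= [].
    by move=> [].
  move=> Aw Yw; do !split => //; move=> Yz.
  by move: zr; rewrite -Yz Yw yr.
congr prob; apply/seteqP; split => w /=.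
  move=> [[Aw Yz] Yr]; split => //; rewrite inE; apply/negP; rewrite negb_or.
  by apply/andP; split; [exact/eqP | exact/negP].
move=> [Aw]; rewrite inE => /negP; rewrite negb_or => /andP[Yz Yr].
by split; [split => //; exact/eqP | exact/negP].
Qed.

End ProbTools.

Section Phase.
Context (dur : nat -> nat).
Context (dur_cvg : end_time dur n @[n --> \oo] --> \oo).

Lemma end_time0 : end_time dur 0 = 0%N.
Proof. by rewrite /end_time big_geq. Qed.

Lemma end_timeS n : end_time dur n.+1 = (end_time dur n + dur n.+1)%N.
Proof. by rewrite /end_time big_nat_recr. Qed.

Lemma end_time_le m n : (m <= n)%N -> (end_time dur m <= end_time dur n)%N.
Proof.
move=> /subnKC <-; elim: (n - m)%N => [|k IH]; first by rewrite addn0.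
by rewrite addnS end_timeS (leq_trans IH) // leq_addr.
Qed.

Lemma end_time_gt s : exists n, (s < end_time dur n)%N.
Proof.
have /cvgnyPgt/(_ s)[N _ /(_ N)] := dur_cvg.
by move=> /(_ (leqnn N)) H; exists N.
Qed.

(** The index n with T_(n-1) <= s < T_n. *)
Definition phase s : nat := ex_minn (end_time_gt s).

Lemma phase_lt s : (s < end_time dur (phase s))%N.
Proof. by rewrite /phase; case: ex_minnP. Qed.

Lemma phase_le s n : (s < end_time dur n)%N -> (phase s <= n)%N.
Proof. by rewrite /phase; case: ex_minnP => m _; apply. Qed.

Lemma phase_ge s n : (end_time dur n <= s)%N -> (n < phase s)%N.
Proof.
move=> ns; rewrite ltnNge; apply/negP => /end_time_le H.
by have := phase_lt s; lia.
Qed.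

Lemma phase_gt0 s : (0 < phase s)%N.
Proof. by apply: phase_ge; rewrite end_time0. Qed.

Lemma phase_end s : (end_time dur (phase s).-1 <= s)%N.
Proof.
rewrite leqNgt; apply/negP => /phase_le; have := phase_gt0 s; lia.
Qed.

Lemma phase_homo s t : (s <= t)%N -> (phase s <= phase t)%N.
Proof. by move=> st; apply: phase_le; exact: leq_ltn_trans (phase_lt t). Qed.

End Phase.

Section WalkLaw.
Context {R : realType} {d : nat} (d_ge4 : (4 <= d)%N) {dur : nat -> nat}
  (dur_cvg : end_time dur n @[n --> \oo] --> \oo)
  {disp : measure_display} {Omega : measurableType disp}
  (Pr : probability Omega R) (X : nat -> Omega -> 'rV[int]_d)
  (X_walk : is_walk Pr (box_rwogg R d_ge4 dur_cvg) 0 X).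

Local Notation phase := (phase dur_cvg).

Let d0 : (0 < d)%N. Proof. exact: leq_trans d_ge4. Qed.

Let mX t x : measurable (X t @^-1` [set x]) := walk_measurable X_walk t x.

Lemma trajectoryS x t :
  trajectory X x t.+1 = trajectory X x t `&` X t.+1 @^-1` [set x t.+1].
Proof.
apply/seteqP; split => w /=.
  by move=> H; split; [move=> s st; apply: H; exact: leqW | exact: H].
by move=> [H1 H2] s; rewrite leq_eqVlt => /orP[/eqP -> //|]; exact: H1.
Qed.

Lemma trajectory0 x : trajectory X x 0 = X 0%N @^-1` [set x 0%N].
Proof.
apply/seteqP; split => w /= H; first exact: H.
by move=> s; rewrite leqn0 => /eqP ->.
Qed.

Lemma measurable_trajectory x t : measurable (trajectory X x t).
Proof.
elim: t => [|t IH]; first by rewrite trajectory0.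
by rewrite trajectoryS; exact: measurableI.
Qed.

Lemma eq_trajectory x y t : (forall s, (s <= t)%N -> x s = y s) ->
  trajectory X x t = trajectory X y t.
Proof.
by move=> xy; apply/seteqP; split => w H s st; rewrite H ?xy.
Qed.

Lemma prob_step x s : box_vertex (phase s) (x s) -> box_vertex (phase s) (x s.+1) ->
  prob Pr (trajectory X x s.+1) =
  prob Pr (trajectory X x s) * box_trans R (phase s) (x s) (x s.+1).
Proof.
have p0 := phase_gt0 dur_cvg s; have pE := prednK p0.
move=> xs xs1; apply: EFin_inj; rewrite EFinM -!probE; try exact: measurable_trajectory.
have := @walk_step _ _ _ _ _ _ _ _ X_walk (phase s).-1 s x.
by rewrite /= pE; apply => //; rewrite phase_end phase_lt.
Qed.

Lemma delta_absv (x : 'rV[int]_d) : delta (absv x) = (x == 0)%:R :> R.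
Proof.
rewrite /delta; congr (_%:R); congr nat_of_bool; apply/forallP/eqP => [H|-> i].
  by apply/rowP => i; move: (H i); rewrite absz_eq0 mxE => /eqP.
by rewrite /absv mxE.
Qed.

Lemma measurable_preim_seq t (r : seq 'rV[int]_d) :
  measurable [set w | X t w \in r].
Proof.
elim: r => [|z r IH].
  by rewrite (_ : [set _ | _] = set0) //; apply/seteqP; split.
rewrite (_ : [set _ | _] = X t @^-1` [set z] `|` [set w | X t w \in r]).
  exact: measurableU.
apply/seteqP; split => w /=; rewrite inE.
  by move=> /orP[/eqP|]; [left|right].
by move=> [->|->]; rewrite ?eqxx ?orbT.
Qed.

(** The Markov property, by induction on the number k of remaining steps: the
    event is split along the position at time s + 1. *)
Lemma prob_return k s x : box_vertex (phase s) (x s) ->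
  prob Pr (trajectory X x s `&` X (s + k)%N @^-1` [set 0]) =
  prob Pr (trajectory X x s) * ret (map phase (iota s k)) (absv (x s)).
Proof.
elim: k s x => [|k IH] s x xs.
  rewrite addn0 /= delta_absv; have [x0|x0] := eqVneq (x s) 0.
    have -> : trajectory X x s `&` X s @^-1` [set 0] = trajectory X x s.
      by apply/seteqP; split => w //= => [[]//|H]; split => //; rewrite H.
    by rewrite mulr1.
  have -> : trajectory X x s `&` X s @^-1` [set 0] = set0.
    apply/seteqP; split => w //= [/(_ s (leqnn s)) -> xs0].
    by rewrite xs0 eqxx in x0.
  by rewrite /prob measure0 mulr0.
pose n := phase s.
have Vfin := box_vertex_finite d n.
pose r := finmap.enum_fset (fset_set (@box_vertex d n)).
have r_mem y : (y \in r) = (y \in box_vertex n) by rewrite /r in_fset_set.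
have r_uniq : uniq r by exact: finmap.fset_uniq.
pose xz z t := if (t <= s)%N then x t else z.
have xzE z : trajectory X (xz z) s.+1 = trajectory X x s `&` X s.+1 @^-1` [set z].
  rewrite trajectoryS /xz ltnn; congr (_ `&` _).
  by apply: eq_trajectory => t ts; rewrite ts.
have mt := measurable_trajectory x s.
have stepE z : z \in r -> prob Pr (trajectory X (xz z) s.+1) =
    prob Pr (trajectory X x s) * box_trans R n (x s) z.
  rewrite r_mem inE => zn.
  have := @prob_step (xz z) s; rewrite /xz leqnn ltnn => -> //.
  by congr (prob _ _ * _); apply: eq_trajectory => t ts; rewrite ts.
have n0 : (0 < n)%N by exact: phase_gt0.
(* no mass escapes the box during the step *)
have rest0 : prob Pr (trajectory X x s `\` [set w | X s.+1 w \in r]) = 0.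
  have := prob_partition Pr (mX s.+1) mt r_uniq.
  rewrite big_seq (eq_bigr (fun z => prob Pr (trajectory X x s) * box_trans R n (x s) z)).
    rewrite -big_seq -mulr_sumr.
    have := box_trans_sum R d0 n0 xs; rewrite fsbig_finite //= => ->.
    rewrite mulr1; lra.
  by move=> z zr; rewrite -xzE stepE.
have mA : measurable (X (s + k.+1)%N @^-1` [set 0]) by [].
rewrite (prob_partition Pr (mX s.+1) (measurableI _ _ mt mA) r_uniq).
rewrite [X in _ + X](_ : _ = 0) ?addr0; last first.
  apply/eqP; rewrite eq_le prob_ge0 andbT -rest0; apply: prob_le.
  - by apply: measurableD; [exact: measurableI | exact: measurable_preim_seq].
  - by apply: measurableD => //; exact: measurable_preim_seq.
  - by move=> w /= [[]].
rewrite /= -/n -(@box_trans_sum_absv R d d0 n _ (x s) n0 xs) mulr_sumr.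
rewrite !big_seq; apply: eq_bigr => z zr.
rewrite mulrA -stepE // setIAC -xzE addnS -addSn.
have xzS : xz z s.+1 = z by rewrite /xz ltnn.
have := IH s.+1 (xz z); rewrite xzS => -> //.
move: zr; rewrite r_mem inE => zn i.
apply: le_trans (zn i) _; rewrite lez_nat; exact: phase_homo.
Qed.

Lemma return_probE t :
  return_prob Pr 0 X t = (@ret R d (map phase (iota 0 t)) (fun=> 0%N))%:E.
Proof.
pose x : nat -> 'rV[int]_d := fun=> 0.
have absv0 : absv (0 : 'rV[int]_d) = fun=> 0%N.
  by apply/funext => i; rewrite /absv mxE.
have x0 : box_vertex (phase 0) (x 0%N) by move=> i; rewrite mxE normr0.
have := @prob_return t 0 x x0; rewrite trajectory0 absv0 add0n.
have P0 : prob Pr (X 0%N @^-1` [set 0]) = 1.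
  by apply: EFin_inj; rewrite -probE // -(walk_start X_walk).
rewrite P0 mul1r => <-; rewrite /return_prob -/(X t @^-1` [set 0]) probE //.
(* the event [X_0 != 0] is negligible *)
have mt := mX t 0; have m0 := mX 0%N 0.
have esc0 : prob Pr (X t @^-1` [set 0] `\` X 0%N @^-1` [set 0]) = 0.
  apply/eqP; rewrite eq_le prob_ge0 andbT.
  have <- : prob Pr (~` (X 0%N @^-1` [set 0])) = 0.
    by have := probability_setC Pr m0; rewrite /prob (probE Pr m0) P0 subee // => ->.
  by apply: prob_le => [||w []//]; [exact: measurableD | exact: measurableC].
by rewrite (probDI Pr mt m0) esc0 add0r setIC.
Qed.

End WalkLaw.

(** * Return probabilities and the two series *)

Section Bounds.
Context {R : realType} {d : nat} (d_ge4 : (4 <= d)%N) {dur : nat -> nat}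
  (dur_cvg : end_time dur n @[n --> \oo] --> \oo).

Local Notation phase := (phase dur_cvg).
Local Notation T := (end_time dur).

Let d0 : (0 < d)%N. Proof. exact: leq_trans d_ge4. Qed.

Definition return_at t : R := @ret R d (map phase (iota 0 t)) (fun=> 0%N).

Lemma ret_nseq k m : @ret R d (nseq k m) = iter k (walkop m) delta.
Proof. by elim: k => //= k ->. Qed.

Lemma path_phase m s k : (m <= phase s)%N -> path leq m (map phase (iota s k)).
Proof.
elim: k s m => //= k IH s m ms; rewrite ms /=; apply: IH; exact: phase_homo.
Qed.

Lemma path_nseq a m k : (a <= m)%N -> path leq a (nseq k m).
Proof. by elim: k a => //= k IH a ->; rewrite IH. Qed.

Lemma all2_nseqr m l : all (leq^~ m) l -> all2 leq l (nseq (size l) m).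
Proof. by elim: l => //= a l IH /andP[-> /IH]. Qed.

Lemma all2_nseql m l : all (leq m) l -> all2 leq (nseq (size l) m) l.
Proof. by elim: l => //= a l IH /andP[-> /IH]. Qed.

Lemma return_at_ge0 t : 0 <= return_at t.
Proof. by apply: (@ret_nonneg R d _ _ 1) => //; apply: path_phase; exact: phase_gt0. Qed.

(** All boxes met before time T_m have radius at most m, so the constant
    sequence m bounds the return probability from below. *)
Lemma return_at_ge m t : (0 < m)%N -> (t <= T m)%N -> ~~ odd t ->
  ((m.*2)%:R ^+ d)^-1 <= return_at t.
Proof.
move=> m0 tm te; have -> : m = m.-1.+1 by lia.
apply: (le_trans (iter_delta_ge d0 m.-1 t./2)).
rewrite even_halfK // prednK // -ret_nseq /return_at -{1}(size_iota 0 t) -(size_map phase).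
apply: (@ret_anti R d 1) => //.
- by apply: path_phase; exact: phase_gt0.
- exact: path_nseq.
apply: all2_nseqr; apply/allP => a /mapP[s]; rewrite mem_iota => /andP[_ st] ->.
by apply: phase_le; exact: leq_trans tm.
Qed.

(** The last m^3 steps take place in boxes of radius at least m; the earlier
    steps are handled by [ret_cat_le]. *)
Lemma return_at_le m t : (0 < m)%N -> (T m.-1 + m ^ 3 <= t)%N ->
  return_at t <= (2 + 8 * d%:R) ^+ d / m%:R ^+ d.
Proof.
move=> m0 mt; set K := (m ^ 3)%N in mt *; set s := (t - K)%N.
have tE : t = (s + K)%N by rewrite /s; lia.
have ms : (m <= phase s)%N.
  by rewrite -{1}(prednK m0); apply: phase_ge; rewrite /s; lia.
rewrite /return_at tE iotaD map_cat add0n.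
apply: (@ret_cat_le R d _ _ 1) => //.
  by apply: path_phase; exact: phase_gt0.
move=> y yl.
have ys : inbox (phase s) y.
  apply: inbox_le yl; case: (s) => [|s']; first exact: phase_gt0.
  have -> : iota 0 s'.+1 = rcons (iota 0 s') s' by rewrite -addn1 iotaD cats1.
  by rewrite map_rcons last_rcons; apply: phase_homo.
have p0 := phase_gt0 dur_cvg s.
(* unlike y, its corner belongs to the box of radius m *)
apply: le_trans (cdecr_corner p0 _ ys) _.
  by apply: ret_cdecr => //; exact: path_phase.
apply: le_trans (iter_delta_le d0 _ m0); rewrite -ret_nseq -/K.
rewrite -{2}(size_iota s K) -(size_map phase).
apply: (@ret_anti R d 1) => //.
- exact: path_nseq.
- exact: path_phase.
- apply: all2_nseql; apply/allP => a /mapP[s']; rewrite mem_iota => /andP[ss' _] ->.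
  by apply: leq_trans ms _; exact: phase_homo.
by move=> i; exact: leq_b1.
Qed.

Lemma sum_inv_sqr n : (0 < n)%N ->
  \sum_(1 <= m < n) (m%:R ^+ 2)^-1 <= 2 - 2 / n%:R :> R.
Proof.
case: n => // n _; elim: n => [|n IH]; first by rewrite big_geq //; lra.
rewrite big_nat_recr //=; apply: (le_trans (lerD IH (lexx _))).
rewrite -subr_ge0 -[n.+2%:R]natr1; set x := n.+1%:R.
have x1 : 1 <= x :> R by rewrite /x ler1n.
have -> : 2 - 2 / (x + 1) - (2 - 2 / x + (x ^+ 2)^-1) = (x - 1) / (x ^+ 2 * (x + 1)).
  by field; apply/andP; split; lra.
by rewrite divr_ge0 ?subr_ge0 // mulr_ge0 ?sqr_ge0 //; lra.
Qed.

Lemma inv_exp_le k m : (0 < m)%N -> (2 <= k)%N ->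
  (m%:R ^+ k)^-1 <= (m%:R ^+ 2)^-1 :> R.
Proof.
move=> m0 k2; have mR : 0 < m%:R :> R by rewrite ltr0n.
rewrite lef_pV2 ?posrE ?exprn_gt0 //; apply: ler_weXn2l => //.
by rewrite ler1n.
Qed.

Lemma sum_even_ge a L :
  (L%:R - 1) / 2 <= \sum_(a <= t < a + L) (~~ odd t)%:R :> R.
Proof.
(* the parity of a + L makes the estimate inductive in L *)
suff H : L%:R - 1 + (odd (a + L))%:R <=
    2 * \sum_(a <= t < a + L) (~~ odd t)%:R :> R.
  have : 0 <= (odd (a + L))%:R :> R by [].
  lra.
elim: L => [|L IH].
  rewrite addn0 big_geq //; have : (odd a)%:R <= 1 :> R by rewrite lern1 leq_b1.
  lra.
rewrite addnS big_nat_recr ?leq_addr //= -natr1.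
by move: IH; case: (odd _) => /=; lra.
Qed.

Definition bounded_series (u : nat -> R) :=
  exists C, forall N, \sum_(1 <= n < N) u n <= C.

Lemma bounded_seriesP (u : nat -> R) : (forall n, 0 <= u n) ->
  (\sum_(1 <= n <oo) (u n)%:E = +oo :> \bar R)%E <-> ~ bounded_series u.
Proof.
move=> u0; have ue0 n : (1 <= n)%N -> true -> (0 <= (u n)%:E)%E.
  by move=> _ _; rewrite lee_fin.
split=> [uoo [C uC]|ub].
  have : (\sum_(1 <= n <oo) (u n)%:E <= C%:E)%E.
    apply: lime_le; first exact: is_cvg_nneseries.
    by apply: nearW => n; rewrite sumEFin lee_fin.
  by rewrite uoo.
apply/eqP; rewrite -leye_eq leNgt; apply/negP => uoo; apply: ub.
exists (fine (\sum_(1 <= n <oo) (u n)%:E)%E) => N.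
rewrite -lee_fin fineK; last first.
  by rewrite ge0_fin_numE //; exact: nneseries_ge0.
by rewrite -sumEFin; exact: nneseries_lim_ge.
Qed.

Let u n : R := (dur n)%:R / n%:R ^+ d.

Let u0 n : 0 <= u n. Proof. by rewrite divr_ge0 // exprn_ge0. Qed.

(** The times from T_(m-1) + m^3 to T_m + (m+1)^3 number
    d(m) + 3m^2 + 3m + 1 <= d(m) + 7m^2, and each costs at most C/m^d. *)
Lemma sum_return_at_le M :
  \sum_(0 <= t < T M + M.+1 ^ 3) return_at t <=
  1 + \sum_(1 <= m < M.+1) (2 + 8 * d%:R) ^+ d * (u m + 7 * (m%:R ^+ 2)^-1).
Proof.
set C := (2 + 8 * d%:R) ^+ d.
have C0 : 0 <= C by rewrite exprn_ge0 // addr_ge0 // mulr_ge0.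
elim: M => [|M IH].
  rewrite end_time0 big_nat1 big_geq // addr0; exact: delta_le1.
have b : (T M + M.+1 ^ 3 <= T M.+1 + M.+2 ^ 3)%N.
  by apply: leq_add; [exact: end_time_le | rewrite leq_exp2r].
rewrite (big_cat_nat (leq0n _) b) /= [X in _ <= _ + X]big_nat_recr //= addrA; apply: lerD IH _.
set m := M.+1; have mR : 0 < m%:R :> R by rewrite ltr0n.
apply: (@le_trans _ _ (\sum_(T M + m ^ 3 <= t < T m + m.+1 ^ 3) C / m%:R ^+ d)).
  apply: ler_sum_nat => t /andP[mt _]; exact: (@return_at_le m).
rewrite sumr_const_nat -mulrnAr; apply: ler_wpM2l => //.
have cnt : (T m + m.+1 ^ 3 - (T M + m ^ 3) <= dur m + 7 * m ^ 2)%N.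
  have m1 : (1 <= m)%N by [].
  by rewrite /m end_timeS -/m; clearbody m; nia.
apply: le_trans (_ : (m%:R ^+ d)^-1 *+ (dur m + 7 * m ^ 2) <= _).
  by apply: ler_wpMn2l => //; rewrite invr_ge0 exprn_ge0.
rewrite -[X in X <= _]mulr_natl natrD mulrDl lerD2l natrM natrX -mulrA ler_pM2l //.
have -> : (m%:R ^+ 2)^-1 = m%:R ^+ 2 * (m%:R ^+ 4)^-1 :> R.
  by field; rewrite gt_eqF.
rewrite ler_pM2l ?exprn_gt0 // lef_pV2 ?posrE ?exprn_gt0 //.
by apply: ler_weXn2l => //; rewrite ler1n.
Qed.

(** A phase of length L contains at least (L - 1)/2 even times. *)
Lemma sum_return_at_ge M :
  \sum_(1 <= m < M.+1) ((dur m)%:R - 1) / 2 / (m.*2)%:R ^+ d <=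
  \sum_(1 <= t < (T M).+1) return_at t.
Proof.
elim: M => [|M IH]; first by rewrite end_time0 !big_geq.
rewrite big_nat_recr //= end_timeS -addSn.
rewrite (@big_cat_nat _ _ _ (T M).+1 1 _ xpredT _ isT (leq_addr _ _)) /=; apply: lerD IH _.
set m := M.+1.
apply: le_trans (_ : \sum_((T M).+1 <= t < (T M).+1 + dur m)
    (~~ odd t)%:R / (m.*2)%:R ^+ d <= _); last first.
  apply: ler_sum_nat => t /andP[_ tm].
  have [_|te] := boolP (odd t); first by rewrite mul0r return_at_ge0.
  by rewrite mul1r; apply: (@return_at_ge m) => //; rewrite /m end_timeS -ltnS -addSn.
rewrite -mulr_suml ler_wpM2r ?invr_ge0 ?exprn_ge0 //.
exact: sum_even_ge.
Qed.

(** The error terms of the two estimates, sums of 1/m^d and of 7 m^2/m^d, are both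
    dominated by the convergent series of 1/m^2. *)
Lemma bounded_return_series : bounded_series return_at <-> bounded_series u.
Proof.
split=> -[B HB].
  exists (2 * 2 ^+ d * B + 2) => N.
  case: N => [|N].
    have := HB 1%N; rewrite !big_geq // => B0.
    by rewrite addr_ge0 // mulr_ge0 // mulr_ge0 // exprn_ge0.
  have H : \sum_(1 <= m < N.+1) u m = 2 * 2 ^+ d *
     \sum_(1 <= m < N.+1) ((dur m)%:R - 1) / 2 / (m.*2)%:R ^+ d +
     \sum_(1 <= m < N.+1) (m%:R ^+ d)^-1.
    rewrite mulr_sumr -big_split /=; apply: eq_big_nat => m /andP[m0 _].
    have mR : m%:R != 0 :> R by rewrite pnatr_eq0 -lt0n.
    rewrite /u -mul2n natrM exprMn; field.
    by rewrite !expf_neq0.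
  rewrite H; apply: lerD.
    rewrite ler_pM2l ?mulr_gt0 ?exprn_gt0 //.
    exact: le_trans (sum_return_at_ge N) (HB _).
  apply: le_trans (_ : \sum_(1 <= m < N.+1) (m%:R ^+ 2)^-1 <= _).
    by apply: ler_sum_nat => m /andP[m0 _]; apply: inv_exp_le => //; lia.
  apply: (le_trans (sum_inv_sqr _)) => //.
  by rewrite gerBl divr_ge0.
set C := (2 + 8 * d%:R : R) ^+ d.
have C0 : 0 <= C by rewrite exprn_ge0 // addr_ge0 // mulr_ge0.
exists (1 + C * (B + 7 * 2)) => N.
apply: le_trans (_ : \sum_(0 <= t < T N + N.+1 ^ 3) return_at t <= _).
  case: N => [|N]; first by rewrite big_geq // sumr_ge0 // => t _; exact: return_at_ge0.
  have NT : (N.+1 <= T N.+1 + N.+2 ^ 3)%N.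
    by apply: leq_trans (leq_addl _ _); rewrite (leq_trans (leqnSn _)) // -{1}(expn1 N.+2) leq_exp2l.
  rewrite (big_cat_nat (leq0n N.+1) NT) /= [X in _ <= X + _]big_ltn // -addrA.
  rewrite addrCA lerDl addr_ge0 ?return_at_ge0 //.
  by apply: sumr_ge0 => t _; exact: return_at_ge0.
apply: le_trans (sum_return_at_le N) _; rewrite lerD2l -mulr_sumr ler_wpM2l //.
rewrite big_split /= lerD // -mulr_sumr ler_pM2l //.
apply: (le_trans (sum_inv_sqr _)) => //.
by rewrite gerBl divr_ge0.
Qed.

End Bounds.

Unset Implicit Arguments.
Set Strict Implicit.

Theorem theorem5p2 (R : realType) (d : nat) (d_ge4 : (4 <= d)%N)
    (dur : nat -> nat)
    (dur_cvg : end_time dur n @[n --> \oo] --> \oo)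
    (disp : measure_display) (Omega : measurableType disp)
    (Pr : probability Omega R) (X : nat -> Omega -> 'rV[int]_d)
    (X_walk : is_walk Pr (box_rwogg R d_ge4 dur_cvg) 0 X) :
  ((\sum_(1 <= n <oo) ((dur n)%:R / n%:R ^+ d)%:E = +oo :> \bar R)%E ->
     recurrent Pr 0 X) /\
  ((\sum_(1 <= n <oo) ((dur n)%:R / n%:R ^+ d)%:E <> +oo :> \bar R)%E ->
     transient Pr 0 X).
Proof.
have rE : recurrent Pr 0 X <-> ~ bounded_series (@return_at R d dur dur_cvg).
  rewrite -bounded_seriesP; last exact: return_at_ge0.
  rewrite /recurrent /return_at; under eq_eseriesr do rewrite (return_probE X_walk).
  by [].
have uE : (\sum_(1 <= n <oo) ((dur n)%:R / n%:R ^+ d)%:E = +oo :> \bar R)%E <->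
    ~ bounded_series (fun n => (dur n)%:R / n%:R ^+ d : R).
  by apply: bounded_seriesP => n; rewrite divr_ge0 // exprn_ge0.
have := @bounded_return_series R d d_ge4 dur dur_cvg.
rewrite /transient; tauto.
Qed.
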